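(* Let $n_e \ge 1$ and $T \ge 1$ be integers, let $\gamma \in [0,1]$, and let $A, B \in \mathbb{R}^{n_e \times n_e}$ be left stochastic matrices. Let $\mathbf{x}_0 \in \Delta$ and $\mathbf{u}_t \in \Delta$ for $t = 0, \dots, T-1$, and define recursively $\mathbf{x}_{t+1} = \gamma A \mathbf{x}_t + (1-\gamma) B \mathbf{u}_t$ for $t = 0, \dots, T-1$. Then $\mathbf{x}_{t+1} = \gamma A\mathbf{x}_t + (1-\gamma) B\mathbf{u}_t \in \Delta$ for all $t = 0, \dots, T-1$.
   Context: $\Delta = \{ f \in \mathbb{R}^{n_e} : \sum_{i=1}^{n_e} f_i = 1,\ f_i \ge 0 \text{ for all } i \}$ is the probability simplex in $\mathbb{R}^{n_e}$. A matrix $P = (\mathbf{p}_1, \dots, \mathbf{p}_{n_e}) \in \mathbb{R}^{n_e \times n_e}$ with columns $\mathbf{p}_i$ is called left stochastic if $\mathbf{p}_i \in \Delta$ for every $i = 1, \dots, n_e$. *)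

(* Defs.v *)
From mathcomp Require Import all_boot all_order all_algebra.
From mathcomp Require Import classical_sets reals.

Set Implicit Arguments.
Unset Strict Implicit.
Unset Printing Implicit Defensive.

Import Order.TTheory GRing.Theory Num.Theory.

Local Open Scope classical_set_scope.
Local Open Scope ring_scope.

Definition simplex (R : realType) (n : nat) : set 'cV[R]_n :=
  [set f | \sum_(i < n) f i 0 = 1 /\ forall i : 'I_n, 0 <= f i 0].

Definition left_stochastic (R : realType) (n : nat) (P : 'M[R]_n) : Prop :=
  forall i : 'I_n, simplex (col i P).

(* Main.v *)
Require Import Defs.
From mathcomp Require Import all_boot all_order all_algebra.
From mathcomp Require Import classical_sets reals.

Import Order.TTheory GRing.Theory Num.Theory.

Local Open Scope ring_scope.

(** The simplex is stable under two operations: multiplication by a left stochastic matrix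
    ([left_stochastic_mul_simplex]), and convex combination ([simplex_convex]). Each update is a
    convex combination, with weights [gamma] and [1 - gamma], of the images of two simplex points,
    so membership propagates along the recursion by induction on time. *)

Lemma left_stochastic_mul_simplex (R : realType) (n : nat) (P : 'M[R]_n)
    (f : 'cV[R]_n) :
  left_stochastic P -> simplex f -> simplex (P *m f).
Proof.
move=> hP [sum_f f_ge0]; split=> [|i].
  rewrite (eq_bigr (fun i => \sum_j P i j * f j 0)); last first.
    by move=> i _; rewrite mxE.
  (* With the sums swapped, the weight of [f j 0] is the sum of column [j] of [P], which is 1; the
     total mass of [f] is thus preserved term by term. *)
  rewrite exchange_big /= -[RHS]sum_f; apply: eq_bigr => j _.
  rewrite -mulr_suml -[RHS]mul1r; congr (_ * _).
  by have [<- _] := hP j; apply: eq_bigr => i _; rewrite mxE.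
rewrite mxE; apply: sumr_ge0 => j _; apply: mulr_ge0 => //.
by have [_ /(_ i)] := hP j; rewrite mxE.
Qed.

Lemma simplex_convex (R : realType) (n : nat) (a : R) (f g : 'cV[R]_n) :
  0 <= a <= 1 -> simplex f -> simplex g -> simplex (a *: f + (1 - a) *: g).
Proof.
move=> /andP[a_ge0 a_le1] [sum_f f_ge0] [sum_g g_ge0]; split=> [|i].
  rewrite (eq_bigr (fun i => a * f i 0 + (1 - a) * g i 0)); last first.
    by move=> i _; rewrite !mxE.
  by rewrite big_split /= -!mulr_sumr sum_f sum_g !mulr1 addrC subrK.
by rewrite !mxE addr_ge0 // mulr_ge0 // subr_ge0.
Qed.

Theorem lemma0p1 (R : realType) (ne T : nat) (hne : (1 <= ne)%N) (hT : (1 <= T)%N)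
    (gamma : R) (hgamma : 0 <= gamma <= 1)
    (A B : 'M[R]_ne) (hA : left_stochastic A) (hB : left_stochastic B)
    (x u : nat -> 'cV[R]_ne)
    (hx0 : simplex (x 0%N))
    (hu : forall t : nat, (t < T)%N -> simplex (u t))
    (hx : forall t : nat, (t < T)%N ->
       x t.+1 = gamma *: (A *m x t) + (1 - gamma) *: (B *m u t)) :
  forall t : nat, (t < T)%N -> simplex (x t.+1).
Proof.
(* The claim concerns [x t.+1], so the base case already unfolds one update, starting from [hx0]; in
   the successor case [IHt] supplies the previous state. *)
elim=> [|t IHt] ltT; rewrite hx //; apply: simplex_convex => //.
- exact: left_stochastic_mul_simplex.
- by apply: left_stochastic_mul_simplex => //; apply: hu.
- by apply: left_stochastic_mul_simplex => //; apply/IHt/ltnW.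
- by apply: left_stochastic_mul_simplex => //; apply: hu.
Qed.
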